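(* (i) Let $F$ be a non-empty face of a $d$-dimensional polyhedron $P\subset\mathbb{R}^d$. Then $$m_{\mathcal{P}}(P)\ge m_{\mathcal{P}}(F)+d-\dim(F).$$ In particular, $m_{\mathcal{P}}(P)\ge d$ for every $d$-dimensional polytope $P\subset\mathbb{R}^d$. (ii) $m_{\mathcal{P}}(d+1)\ge m_{\mathcal{P}}(d)+1$ and $\overline{m}_{\mathcal{P}}(d+1)\ge\overline{m}_{\mathcal{P}}(d)+1$.
   Context: A polyhedron is an intersection of finitely many closed halfspaces; a polytope is a bounded polyhedron. For a $d$-dimensional polyhedron $P\subset\mathbb{R}^d$, $m_{\mathcal{P}}(P)$ denotes the minimal number $l$ of polynomials $\mathfrak{p}_1,\dots,\mathfrak{p}_l\in\mathbb{R}[x_1,\dots,x_d]$ such that $P=\{x\in\mathbb{R}^d : \mathfrak{p}_1(x)\ge0,\dots,\mathfrak{p}_l(x)\ge0\}$; in particular $m_{\mathcal{P}}(\mathbb{R}^d)=0$. For a polyhedron $\tilde P\subset\mathbb{R}^d$ with $\dim(\tilde P)<d$, $m_{\mathcal{P}}(\tilde P)$ is the minimal number of polynomials in $\dim(\tilde P)$ variables needed to describe, in this way, an (affine) embedding of $\tilde P$ in $\mathbb{R}^{\dim(\tilde P)}$ (the number is invariant under regular affine transformations; it is $0$ for a point). Moreover $$\overline{m}_{\mathcal{P}}(d)=\max\{m_{\mathcal{P}}(P): P\subset\mathbb{R}^d\text{ a }d\text{-dimensional polyhedron}\},$$ $$m_{\mathcal{P}}(d)=\max\{m_{\mathcal{P}}(P):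 P\subset\mathbb{R}^d\text{ a }d\text{-dimensional polytope}\}.$$ These maxima are finite: by a theorem of Bröcker and Scheiderer both are at most $d(d+1)/2$. *)

(* Defs.v *)
From HB Require Import structures.
From mathcomp Require Import all_boot all_order all_algebra.
From mathcomp Require Import mpoly.
From mathcomp Require Import boolp classical_sets reals ereal normedtype.
Set Implicit Arguments.
Unset Strict Implicit.
Unset Printing Implicit Defensive.
Import Order.TTheory GRing.Theory Num.Theory numFieldNormedType.Exports.
Local Open Scope classical_set_scope.
Local Open Scope ring_scope.

Definition dotp (R : realType) (d : nat) (a x : 'rV[R]_d) : R :=
  \sum_i a ord0 i * x ord0 i.

Definition closed_halfspace (R : realType) (d : nat) (H : set 'rV[R]_d) : Prop :=
  exists (a : 'rV[R]_d) (b : R), a != 0 /\ H = [set x | dotp a x <= b].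

Definition polyhedron (R : realType) (d : nat) (P : set 'rV[R]_d) : Prop :=
  exists (m : nat) (H : 'I_m -> set 'rV[R]_d),
    (forall i, closed_halfspace (H i)) /\ P = \bigcap_i H i.

Definition polytope (R : realType) (d : nat) (P : set 'rV[R]_d) : Prop :=
  polyhedron P /\ bounded_set P.

(* [a = 0] is allowed, so that [P] is a face of itself. *)
Definition face (R : realType) (d : nat) (F P : set 'rV[R]_d) : Prop :=
  exists (a : 'rV[R]_d) (b : R),
    P `<=` [set x | dotp a x <= b] /\ F = P `&` [set x | dotp a x = b].

Definition affine_hull (R : realType) (d : nat) (S : set 'rV[R]_d) :
    set 'rV[R]_d :=
  [set x | exists (n : nat) (c : 'I_n -> R) (p : 'I_n -> 'rV[R]_d),
     [/\ forall i, S (p i), \sum_i c i = 1 & x = \sum_i c i *: p i]].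

(* A relation rather than a function: the empty set has no dimension here, so
   "d-dimensional" entails "non-empty", including for d = 0. *)
Definition has_dim (R : realType) (d : nat) (S : set 'rV[R]_d) (k : nat) : Prop :=
  exists (x0 : 'rV[R]_d) (V : {vspace 'rV[R]_d}),
    \dim V = k /\ affine_hull S = [set x | x - x0 \in V].

Definition described_by (R : realType) (d l : nat) (S : set 'rV[R]_d)
    (p : 'I_l -> {mpoly R[d]}) : Prop :=
  S = [set x | forall i, 0 <= (p i).@[fun j => x ord0 j]].

(* For an affine map, injectivity on the affine hull of [S] makes its
   restriction to that hull an affine isomorphism onto the image. *)
Definition affine_embedding (R : realType) (d k : nat) (S : set 'rV[R]_d)
    (f : 'rV[R]_d -> 'rV[R]_k) : Prop :=
  (exists (A : 'M[R]_(d, k)) (b : 'rV[R]_k), forall x, f x = x *m A + b) /\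
  (forall x y, affine_hull S x -> affine_hull S y -> f x = f y -> x = y).

(* [l] polynomials suffice for [P]: in d variables if [P] is full-dimensional,
   and otherwise, with k = dim P < d, in k variables for some affine copy of
   [P] in R^k. *)
Definition describable (R : realType) (d : nat) (P : set 'rV[R]_d) (l : nat) :
    Prop :=
  (has_dim P d /\ exists p : 'I_l -> {mpoly R[d]}, described_by P p) \/
  (exists k : nat, [/\ (k < d)%N, has_dim P k &
     exists (f : 'rV[R]_d -> 'rV[R]_k) (p : 'I_l -> {mpoly R[k]}),
       affine_embedding P f /\ described_by (f @` P) p]).

(* The least [l] with [describable P l]. The default value 0 of [xget] only
   occurs if there is no such [l], hence never for a non-empty polyhedron,
   which is described by the affine polynomials of its halfspaces. *)
Definition mP (R : realType) (d : nat) (P : set 'rV[R]_d) : nat :=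
  xget 0%N [set l | describable P l /\
                    forall l', describable P l' -> (l <= l')%N].

(* The two maxima, as suprema in the extended reals: a supremum of a non-empty
   set of natural numbers is its maximum as soon as it is finite, and it is
   finite here, being at most d(d+1)/2 (Broecker, Scheiderer). *)
Definition mP_max_polyhedron (R : realType) (d : nat) : \bar R :=
  ereal_sup [set ((mP P)%:R)%:E | P in
    [set P : set 'rV[R]_d | polyhedron P /\ has_dim P d]].

Definition mP_max_polytope (R : realType) (d : nat) : \bar R :=
  ereal_sup [set ((mP P)%:R)%:E | P in
    [set P : set 'rV[R]_d | polytope P /\ has_dim P d]].

(* Main.v *)
Require Import Defs.
From mathcomp Require Import all_boot all_order all_algebra.
From mathcomp Require Import mpoly ring lra.
From mathcomp Require Import boolp classical_sets reals ereal topology.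
From mathcomp Require Import normedtype derive.
Set Implicit Arguments.
Unset Strict Implicit.
Unset Printing Implicit Defensive.
Import Order.TTheory GRing.Theory Num.Theory numFieldNormedType.Exports.
Local Open Scope classical_set_scope.
Local Open Scope ring_scope.

(** Let P be a full-dimensional polyhedron described by polynomials p_1, ..., p_n,
    and let G be a facet of P. Arbitrarily close to any point of the relative
    interior of G there are points outside P, at which some p_i is negative,
    while p_i >= 0 on G; so the product of the p_i vanishes on a relatively open
    part of the hyperplane spanned by G, hence on this hyperplane, and therefore
    one of the p_i vanishes on it (vanishing_on_hyperplane). The others describe G
    inside the hyperplane. A proper face of P lies in some facet, of which it is
    a face, and induction on the dimension produces, for a k-dimensional face F,
    a description of F by at most n - (d - k) polynomials (face_parametrization).
    This is the first inequality of (i); for a polytope, it is applied to a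
    vertex, namely a point of largest Euclidean norm (polytope_vertex).

    For (ii), P is the base of the prism over P, up to an affine isomorphism, and
    this base is a face of codimension one, so the prism needs at least one
    polynomial more than P (mP_prism). The prism over a polytope is a polytope.

    Vanishing and positivity are only ever tested along lines, where they concern
    univariate polynomials; the induction is therefore carried out for functions
    whose restriction to every line is polynomial (line_polynomial). Facets are
    moved to coordinate spaces by affine parametrizations, so that every
    polyhedron in the induction is full-dimensional, which is expressed by a
    point satisfying all its inequalities strictly. *)

(** * Functions that are polynomial along every line *)

Section Lines.
Variable R : realType.

Definition affine_function d (l : 'rV[R]_d -> R) : Prop :=
  exists (a : 'rV[R]_d) (b : R), forall x, l x = dotp a x - b.

(** This property of polynomial functions passes to affine substitutions by mere
    composition, which spares the induction on the dimension all substitutions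
    into multivariate polynomials. *)
Definition line_polynomial d (f : 'rV[R]_d -> R) : Prop :=
  forall x v, exists q : {poly R}, forall t, f (x + t *: v) = q.[t].

Lemma dotp_mulmx d (a x : 'rV[R]_d) : dotp a x = (x *m a^T) 0 0.
Proof. by rewrite mxE; apply: eq_bigr => i _; rewrite !mxE mulrC. Qed.

Lemma dotpDZ d (a x v : 'rV[R]_d) t :
  dotp a (x + t *: v) = dotp a x + t * dotp a v.
Proof. by rewrite !dotp_mulmx mulmxDl -scalemxAl !mxE. Qed.

Lemma affine_function_line d (l : 'rV[R]_d -> R) x y t : affine_function l ->
  l (x + t *: (y - x)) = l x + t * (l y - l x).
Proof.
move=> [a [b lE]]; rewrite !lE dotpDZ.
have -> : dotp a (y - x) = dotp a y - dotp a x.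
  by rewrite -scaleN1r dotpDZ mulN1r.
ring.
Qed.

Lemma affine_function_comp d k (l : 'rV[R]_d -> R) (M : 'M[R]_(k, d)) u :
  affine_function l -> affine_function (fun t => l (t *m M + u)).
Proof.
move=> [a [b lE]]; exists (a *m M^T), (b - dotp a u) => t.
have -> : dotp (a *m M^T) t = dotp a (t *m M).
  by rewrite !dotp_mulmx trmx_mul trmxK mulmxA.
by rewrite lE [t *m M + u]addrC -[t *m M]scale1r dotpDZ scale1r; ring.
Qed.

Lemma affine_line_polynomial d (l : 'rV[R]_d -> R) :
  affine_function l -> line_polynomial l.
Proof.
move=> [a [b lE]] x v; exists ((dotp a v)%:P * 'X + (dotp a x - b)%:P) => t.
by rewrite lE dotpDZ hornerD hornerM !hornerC hornerX; ring.
Qed.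

Lemma line_polynomial_comp d k (f : 'rV[R]_d -> R) (M : 'M[R]_(k, d)) u :
  line_polynomial f -> line_polynomial (fun t => f (t *m M + u)).
Proof.
move=> fP x v; have [q qE] := fP (x *m M + u) (v *m M); exists q => t.
by rewrite -qE mulmxDl -scalemxAl addrAC.
Qed.

Lemma line_polynomialN d (f : 'rV[R]_d -> R) :
  line_polynomial f -> line_polynomial (fun x => - f x).
Proof.
by move=> fP x v; have [q qE] := fP x v; exists (- q) => t; rewrite hornerN qE.
Qed.

Lemma line_polynomial_prod d (J : Type) (f : J -> 'rV[R]_d -> R) (s : seq J) :
  (forall j, line_polynomial (f j)) ->
  line_polynomial (fun x => \prod_(j <- s) f j x).
Proof.
move=> fP x v; elim: s => [|j s [q qE]].
  by exists 1 => t; rewrite big_nil hornerE.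
have [r rE] := fP j x v; exists (r * q) => t.
by rewrite big_cons hornerM qE rE.
Qed.

Lemma mpoly_line_polynomial d (p : {mpoly R[d]}) :
  line_polynomial (fun x : 'rV[R]_d => p.@[fun j => x ord0 j]).
Proof.
move=> x v; pose c j := (v ord0 j)%:P * 'X + (x ord0 j)%:P.
exists (\sum_(m <- msupp p) (p@_m)%:P * \prod_i c i ^+ m i) => t.
rewrite mevalE horner_sum; apply: eq_bigr => m _.
rewrite !hornerE horner_prod; congr (_ * _); apply: eq_bigr => i _.
by rewrite horner_exp !hornerE !mxE addrC mulrC.
Qed.

Lemma line_polynomial_near_gt0 d (f : 'rV[R]_d -> R) x v :
  line_polynomial f -> 0 < f x -> \forall t \near 0^'+, 0 < f (x + t *: v).
Proof.
move=> fP fx; have [q qE] := fP x v.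
have q0 : 0 < q.[0] by rewrite -qE scale0r addr0.
have qc : q.[t] @[t --> 0^'+] --> q.[0].
  by apply: cvg_at_right_filter; exact: continuous_horner.
have := cvgr_gt _ qc _ q0.
move=> qpos; near=> t; rewrite qE; near: t; exact: qpos.
Unshelve. all: by end_near. Qed.

Lemma near_right0_ex (P : R -> Prop) :
  (\forall t \near 0^'+, P t) -> exists2 t, 0 < t & P t.
Proof.
move=> nP; have : \forall t \near (0 : R)^'+, 0 < t /\ P t.
  by near=> t; split; near: t => //; exact: nbhs_right_gt.
by move=> /filter_ex[t [t0 Pt]]; exists t.
Unshelve. all: by end_near. Qed.

(** A nonzero polynomial has finitely many roots, whereas e/2, e/3, e/4, ... all
    lie in a right neighbourhood of 0 of radius e. *)
Lemma near_right0_poly_eq0 (q : {poly R}) :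
  (\forall t \near 0^'+, q.[t] = 0) -> q = 0.
Proof.
move=> [e /= e0 He].
apply: (@roots_geq_poly_eq0 _ _ [seq e / i.+2%:R | i <- iota 0 (size q)]).
- apply/allP => _ /mapP[i _ ->]; rewrite /root; apply/eqP/He => /=; last first.
    by rewrite divr_gt0.
  rewrite sub0r normrN gtr0_norm ?divr_gt0//.
  by rewrite ltr_pdivrMr// ltr_pMr// ltr1n.
- rewrite map_inj_uniq ?iota_uniq// => i j /(mulfI (lt0r_neq0 e0))/invr_inj.
  by move=> /eqP; rewrite eqr_nat => /eqP[].
- by rewrite size_map size_iota.
Qed.

(** If neither factor were zero, say at x and at y respectively, both would
    restrict to nonzero polynomials on the line through x and y, and so would
    their product. *)
Lemma line_polynomial_domain d (f g : 'rV[R]_d -> R) :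
  line_polynomial f -> line_polynomial g -> (forall x, f x * g x = 0) ->
  (forall x, f x = 0) \/ (forall x, g x = 0).
Proof.
move=> fP gP fg0; apply: contrapT => /not_orP[/existsNP[x fx] /existsNP[y gy]].
have [q qE] := fP x (y - x); have [r rE] := gP x (y - x).
have /eqP : q * r = 0.
  by apply: near_right0_poly_eq0; near=> t; rewrite hornerM -qE -rE fg0.
rewrite mulf_eq0 => /orP[]/eqP s0.
- by apply: fx; have := qE 0; rewrite s0 scale0r addr0 horner0.
- by apply: gy; have := rE 1; rewrite s0 scale1r addrC subrK horner0.
Unshelve. all: by end_near. Qed.

Lemma line_polynomial_prod_eq0 d (J : eqType) (f : J -> 'rV[R]_d -> R)
    (s : seq J) :
  (forall j, line_polynomial (f j)) ->
  (forall x, \prod_(j <- s) f j x = 0) ->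
  exists2 j, j \in s & forall x, f j x = 0.
Proof.
move=> fP; elim: s => [|j s IH] s0.
  by have /eqP := s0 0; rewrite big_nil oner_eq0.
have [] := @line_polynomial_domain _ (f j) (fun x => \prod_(j <- s) f j x).
- exact: fP.
- exact: line_polynomial_prod.
- by move=> x; rewrite -[RHS](s0 x) big_cons.
- by exists j; rewrite ?mem_head.
- by move=> /IH[i si fi]; exists i; rewrite ?inE ?si ?orbT.
Qed.

End Lines.

(** * Affine hulls and dimension *)

Section AffineHulls.
Variable R : realType.

Lemma sub_affine_hull d (S : set 'rV[R]_d) : S `<=` affine_hull S.
Proof.
move=> x Sx; exists 1, (fun=> 1), (fun=> x); split=> //.
- by rewrite big_ord1.
- by rewrite big_ord1 scale1r.
Qed.

Lemma affine_hull_line d (S : set 'rV[R]_d) x y t :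
  affine_hull S x -> affine_hull S y -> affine_hull S (x + t *: (y - x)).
Proof.
move=> [n [c [p [Sp c1 ->]]]] [m [e [q [Sq e1 ->]]]].
exists (n + m)%N,
  (fun k => match split k with inl i => (1 - t) * c i | inr j => t * e j end),
  (fun k => match split k with inl i => p i | inr j => q j end); split.
- by move=> k; case: (split k).
- rewrite big_split_ord /=.
  under eq_bigr do rewrite (unsplitK (inl _)).
  under [X in _ + X]eq_bigr do rewrite (unsplitK (inr _)).
  by rewrite -!mulr_sumr c1 e1; ring.
- rewrite big_split_ord /=.
  under [X in _ = X + _]eq_bigr do rewrite (unsplitK (inl _)) -scalerA.
  under [X in _ = _ + X]eq_bigr do rewrite (unsplitK (inr _)) -scalerA.
  rewrite -!scaler_sumr scalerBl scale1r scalerBr addrA; exact: addrAC.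
Qed.

Lemma affine_hull_image d k (S : set 'rV[R]_k) (M : 'M[R]_(k, d)) u x :
  affine_hull S x -> affine_hull [set t *m M + u | t in S] (x *m M + u).
Proof.
move=> [n [c [p [Sp c1 ->]]]].
exists n, c, (fun i => p i *m M + u); split=> //; first by move=> i; exists (p i).
rewrite mulmx_suml; under [RHS]eq_bigr do rewrite scalerDr scalemxAl.
by rewrite big_split /= -scaler_suml c1 scale1r.
Qed.

Lemma affine_hull_mono d (S T : set 'rV[R]_d) :
  S `<=` T -> affine_hull S `<=` affine_hull T.
Proof.
move=> ST _ [n [c [p [Sp c1 ->]]]]; exists n, c, p; split=> // i; exact: ST.
Qed.

Lemma affine_hull_eq0 d (S : set 'rV[R]_d) (l : 'rV[R]_d -> R) :
  affine_function l -> (forall x, S x -> l x = 0) ->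
  forall x, affine_hull S x -> l x = 0.
Proof.
move=> [a [b lE]] l0 _ [n [c [p [Sp c1 ->]]]].
rewrite lE dotp_mulmx mulmx_suml summxE -[b]mul1r -c1 mulr_suml -sumrB big1// => i _.
by rewrite -scalemxAl mxE -dotp_mulmx -mulrBr -lE l0 ?mulr0.
Qed.

(** Every y is an affine combination of x and of a point of S on the segment
    from x to y. *)
Lemma affine_hull_setT d (S : set 'rV[R]_d) x :
  S x -> (forall v, \forall t \near 0^'+, S (x + t *: v)) ->
  affine_hull S = setT.
Proof.
move=> Sx Sv; apply/seteqP; split=> // y _.
have [t t0 St] := near_right0_ex (Sv (y - x)).
have -> : y = x + t^-1 *: (x + t *: (y - x) - x).
  rewrite [x + t *: _]addrC addrK scalerA mulVf ?lt0r_neq0//.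
  by rewrite scale1r [x + _]addrC subrK.
by apply: affine_hull_line; apply: sub_affine_hull.
Qed.

Lemma has_dim_uniq d (S : set 'rV[R]_d) j k : has_dim S j -> has_dim S k -> j = k.
Proof.
suff main x y (V W : {vspace 'rV[R]_d}) :
    [set z | z - x \in V] = [set z | z - y \in W] -> (V <= W)%VS.
  move=> [x [V [<- SV]]] [y [W [<- SW]]]; rewrite SV in SW.
  apply/eqP; rewrite eqn_leq; apply/andP.
  by split; apply: dimvS; [exact: (main x y)|exact: (main y x)].
move=> /seteqP[VW _]; apply/subvP => v Vv.
have Wx : x - y \in W by apply: VW => /=; rewrite subrr mem0v.
have : x + v - y \in W by apply: VW => /=; rewrite addrC addKr.
by rewrite addrAC rpredDl.
Qed.

Lemma has_dim_param d k (G : set 'rV[R]_k) (M : 'M[R]_(k, d)) u :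
  row_free M -> affine_hull G = setT -> has_dim [set t *m M + u | t in G] k.
Proof.
move=> Mfree GT; pose f : 'Hom('rV[R]_k, 'rV[R]_d) := linfun (mulmxr M).
exists u, (limg f); split.
  rewrite limg_dim_eq ?dimvf; last first.
    apply/eqP; rewrite -subv0; apply/subvP => t.
    rewrite memv_cap memvf memv_ker lfunE /= memv0.
    by rewrite mulmx_free_eq0.
  by rewrite /dim /= mul1n.
apply/seteqP; split.
  move=> _ [n [c [p [Gp c1 ->]]]] /=.
  rewrite -[u]scale1r -c1 scaler_suml -sumrB; apply: rpred_sum => i _.
  rewrite -scalerBr; apply: rpredZ; have [t _ <-] := Gp i; rewrite addrK.
  by have := memv_img f (memvf t); rewrite lfunE.
move=> x /= /memv_imgP[t _]; rewrite lfunE /= => xE.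
rewrite -[x](subrK u) xE; apply: affine_hull_image; by rewrite GT.
Qed.

Lemma has_dim_setT d (S : set 'rV[R]_d) : has_dim S d <-> affine_hull S = setT.
Proof.
split=> [[x [V [dV ->]]]|ST].
  have /eqP -> : V == fullv by rewrite eqEdim subvf dimvf dV /dim /= mul1n.
  by apply/seteqP; split=> // y _ /=; rewrite memvf.
have := @has_dim_param _ _ S 1%:M 0 _ ST.
rewrite (_ : [set _ | _ in _] = S); first by apply; rewrite row_free_unit unitmx1.
by apply/seteqP; split=> [_ [t St <-]|x Sx]; [|exists x => //]; rewrite mulmx1 addr0.
Qed.

Lemma has_dim_nonempty d (P : set 'rV[R]_d) k : has_dim P k -> P !=set0.
Proof.
move=> [x [V [_ PV]]]; have : affine_hull P x by rewrite PV /= subrr mem0v.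
move=> [[|n] [c [p [Pp c1 _]]]]; last by exists (p ord0).
by move/eqP: c1; rewrite big_ord0 eq_sym oner_eq0.
Qed.

End AffineHulls.

(** * Descending to a face, one facet at a time *)

Section Faces.
Variable R : realType.

(** Inequalities are selected by an index set, so that passing to a facet amounts
    to removing indices while the families themselves stay indexed by the same
    type. *)
Definition nonpos_on d m (l : 'I_m -> 'rV[R]_d -> R) (K : {set 'I_m}) :
    set 'rV[R]_d := [set x | forall i, i \in K -> l i x <= 0].

Definition nonneg_on d n (p : 'I_n -> 'rV[R]_d -> R) (I : {set 'I_n}) :
    set 'rV[R]_d := [set x | forall i, i \in I -> 0 <= p i x].

(** Midpoints of points that are strict for different constraints are strict for
    all of them. This gives an interior point of a full-dimensional polyhedron,
    and also shows that a face which meets the interior is not proper. *)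
Lemma common_strict_point d m (l : 'I_m -> 'rV[R]_d -> R) (K : {set 'I_m})
    (C : set 'rV[R]_d) :
  (forall i, affine_function (l i)) -> C !=set0 -> C `<=` nonpos_on l K ->
  (forall x y, C x -> C y -> C (x + 2^-1 *: (y - x))) ->
  (forall i, i \in K -> exists2 x, C x & l i x < 0) ->
  exists2 x, C x & forall i, i \in K -> l i x < 0.
Proof.
move=> lA [x0 Cx0] CK Cmid Cl.
suff main (s : seq 'I_m) : {subset s <= K} ->
    exists2 x, C x & forall i, i \in s -> l i x < 0.
  have [|x Cx lx] := main (enum K); first by move=> i; rewrite mem_enum.
  by exists x => // i iK; apply: lx; rewrite mem_enum.
elim: s => [|j s IH] sK; first by exists x0.
have [|x Cx lx] := IH; first by move=> i si; apply: sK; rewrite inE si orbT.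
have jK : j \in K by apply: sK; rewrite mem_head.
have [y Cy ly] := Cl j jK.
exists (x + 2^-1 *: (y - x)) => [|i]; first exact: Cmid.
rewrite affine_function_line// inE => /predU1P[->|si].
  have := CK x Cx j jK; lra.
have := lx i si; have := CK y Cy i (sK i _); rewrite inE si orbT => /(_ isT); lra.
Qed.

Lemma strict_near d m (l : 'I_m -> 'rV[R]_d -> R) (K : {set 'I_m}) x v :
  (forall i, affine_function (l i)) -> (forall i, i \in K -> l i x < 0) ->
  \forall t \near 0^'+, forall i, i \in K -> l i (x + t *: v) < 0.
Proof.
move=> lA lx; apply: filter_forall => i.
have [iK|] := boolP (i \in K); last by move=> _; near=> t.
have := @line_polynomial_near_gt0 _ _ (fun x => - l i x) x v.
rewrite oppr_gt0 => /(_ _ (lx i iK))[]; last first.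
  by move=> e e0 H; exists e => // t te t0 _; rewrite -oppr_gt0; exact: H.
exact/line_polynomialN/affine_line_polynomial.
Unshelve. all: by end_near. Qed.

Lemma hyperplane_param d (l : 'rV[R]_d -> R) u w :
  affine_function l -> l u = 0 -> l w != 0 ->
  exists k (M : 'M[R]_(k, d)), [/\ d = k.+1, row_free M,
    forall t, l (t *m M + u) = 0 &
    forall x, l x = 0 -> exists t, x = t *m M + u].
Proof.
move=> [a [b lE]] lu lw; pose N := kermx a^T.
have lN x : l x = ((x - u) *m a^T) 0 0.
  by rewrite -[LHS]subr0 -lu !lE mulmxBl !dotp_mulmx !mxE; ring.
have a0 : a != 0.
  apply: contra_neq lw => a0; rewrite lN a0 trmx0 mulmx0 mxE//.
have d0 : (0 < d)%N.
  by case: d {l lE lu lw lN N u w} a a0 => // a; rewrite [a]thinmx0 eqxx.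
have rN : \rank N = d.-1 by rewrite mxrank_ker mxrank_tr rank_rV a0 subn1.
exists (\rank N), (row_base N); split.
- by rewrite rN prednK.
- exact: row_base_free.
- move=> t; rewrite lN addrK.
  suff -> : t *m row_base N *m a^T = 0 by rewrite mxE.
  by apply/sub_kermxP; rewrite (submx_trans (submxMl _ _))// eq_row_base.
- move=> x lx; have : (x - u <= row_base N)%MS.
    rewrite eq_row_base; apply/sub_kermxP/matrixP => i j.
    by rewrite !ord1 -lN lx mxE.
  by move=> /submxP[t xE]; exists t; rewrite -xE subrK.
Qed.

(** In an irredundant system, each constraint is violated alone at some point;
    this is what makes its zero set carry a facet. *)
Lemma irredundant_subset d m (l : 'I_m -> 'rV[R]_d -> R) (K : {set 'I_m}) :
  exists K' : {set 'I_m}, [/\ K' \subset K, nonpos_on l K' = nonpos_on l K &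
    forall j, j \in K' -> exists w, nonpos_on l (K' :\ j) w /\ 0 < l j w].
Proof.
have [|K' /minsetP[/asboolP K'E K'min] K'K] :=
  @minset_exists _ (fun A => `[< nonpos_on l A = nonpos_on l K >]) K.
  by apply/asboolP.
exists K'; split=> // j jK; apply: contrapT => /forallNP now.
suff /asboolP/K'min/(_ (subD1set _ _))/setP/(_ j) :
  nonpos_on l (K' :\ j) = nonpos_on l K by rewrite !inE eqxx jK.
rewrite -K'E; apply/seteqP; split=> x lx i; last by rewrite inE => /andP[_ /lx].
move=> iK; have [->|ij] := eqVneq i j; last by apply: lx; rewrite !inE ij.
by rewrite leNgt; apply/negP => ljx; apply: (now x).
Qed.

(** Leaving the polyhedron through a point x of the facet, that is along w - x,
    violates some polynomial inequality at points arbitrarily close to x; hence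
    some polynomial vanishes at x. The product of all the polynomials thus
    vanishes near u in the hyperplane, so everywhere on it, and one of the
    factors must already do so. *)
Lemma vanishing_on_hyperplane d m n (l : 'I_m -> 'rV[R]_d -> R)
    (K : {set 'I_m}) (p : 'I_n -> 'rV[R]_d -> R) (I : {set 'I_n}) j u w k
    (M : 'M[R]_(k, d)) :
  (forall i, affine_function (l i)) -> (forall i, line_polynomial (p i)) ->
  nonpos_on l K = nonneg_on p I -> j \in K ->
  (forall i, i \in K :\ j -> l i u < 0) -> 0 < l j w ->
  (forall t, l j (t *m M + u) = 0) ->
  exists2 i, i \in I & forall t, p i (t *m M + u) = 0.
Proof.
move=> lA pP KI jK lu lw ljM.
suff H t : \prod_(i <- enum I) p i (t *m M + u) = 0.
  have [|i] := @line_polynomial_prod_eq0 _ _ _ (fun i t => p i (t *m M + u)) _ _ H.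
    by move=> i; exact: line_polynomial_comp.
  by rewrite mem_enum => iI pi0; exists i.
have [q qE] := @line_polynomial_prod _ _ _ (fun i t => p i (t *m M + u))
  (enum I) (fun i => line_polynomial_comp _ _ (pP i)) 0 t.
suff q0 : q = 0 by have := qE 1; rewrite q0 horner0 add0r scale1r.
apply: near_right0_poly_eq0.
have := strict_near (t *m M) lA lu; apply: filterS => e le.
rewrite -qE add0r -scalemxAl addrC; set x := u + _ in le *.
have ljx : l j x = 0 by rewrite /x addrC scalemxAl.
have Px : nonpos_on l K x.
  move=> i iK; have [->|ij] := eqVneq i j; first by rewrite ljx.
  by apply/ltW/le; rewrite !inE ij.
have [i iI pix] : exists2 i, i \in I & p i x = 0.
  apply: contrapT => /forall2NP px0.
  have px i : i \in I -> 0 < p i x.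
    move=> iI; rewrite lt_neqAle eq_sym; apply/andP; split.
      by apply/eqP; have [|//] := px0 i.
    by have : nonneg_on p I x by [rewrite -KI]; exact.
  have : \forall s \near 0^'+, forall i, i \in I -> 0 < p i (x + s *: (w - x)).
    apply: filter_forall => i; have [iI|_] := boolP (i \in I); last by near=> s.
    have := line_polynomial_near_gt0 (w - x) (pP i) (px i iI).
    by apply: filterS.
  move=> /near_right0_ex[s s0 ps].
  have : nonpos_on l K (x + s *: (w - x)) by rewrite KI => i iI; apply/ltW/ps.
  move=> /(_ j jK); rewrite affine_function_line// ljx subr0 add0r.
  by rewrite leNgt mulr_gt0.
rewrite (perm_big _ (perm_to_rem (_ : i \in enum I))) ?mem_enum//=.
by rewrite big_cons pix mul0r.
Unshelve. all: by end_near. Qed.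

(** The induction that carries the whole result. If g is not identically zero,
    the face where g = 0 lies in a facet cut out by an irredundant constraint
    l j. On the hyperplane l j = 0, one constraint and, by
    vanishing_on_hyperplane, one polynomial become trivial; after an affine
    parametrization of this hyperplane, the facet is a full-dimensional
    polyhedron in one variable less, described by one polynomial less, of which
    the face is still a face. The parametrizations compose. *)
Theorem face_parametrization m n d (l : 'I_m -> 'rV[R]_d -> R) (K : {set 'I_m})
    (p : 'I_n -> 'rV[R]_d -> R) (I : {set 'I_n}) (g : 'rV[R]_d -> R) :
  (forall i, affine_function (l i)) -> (forall i, line_polynomial (p i)) ->
  affine_function g ->
  (exists y, forall i, i \in K -> l i y < 0) ->
  nonpos_on l K = nonneg_on p I ->
  (forall x, nonpos_on l K x -> g x <= 0) ->
  (exists2 z, nonpos_on l K z & g z = 0) ->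
  exists k (M : 'M[R]_(k, d)) u (I' : {set 'I_n}),
    [/\ row_free M, (#|I'| + (d - k) <= #|I|)%N,
        forall x, nonpos_on l K x -> g x = 0 -> exists t, x = t *m M + u,
        forall t, (nonpos_on l K (t *m M + u) /\ g (t *m M + u) = 0) <->
                  nonneg_on p I' (t *m M + u) &
        affine_hull [set t | nonpos_on l K (t *m M + u) /\ g (t *m M + u) = 0]
          = setT].
Proof.
elim/ltn_ind: d => d IH in l K p I g *.
move=> lA pP gA [y0 ly0] KI gK [z Kz gz].
have [K' [K'K KE irr]] := irredundant_subset l K.
rewrite -{}KE in KI gK Kz *.
have {ly0 K'K}ly i : i \in K' -> l i y0 < 0.
  by move=> iK; exact/ly0/(fintype.subsetP K'K).
move: y0 K' irr KI gK Kz ly => y {}K irr KI gK Kz ly.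
have intK x : (forall i, i \in K -> l i x < 0) ->
    forall v, \forall t \near 0^'+, nonpos_on l K (x + t *: v).
  move=> lx v; have := strict_near v lA lx.
  by apply: filterS => t H i iK; apply/ltW/H.
(* A constant g makes the whole polyhedron the face. *)
have [g0|/existsNP[v gv]] := pselect (forall x, g x = 0).
  exists d, 1%:M, 0, I; split.
  - by rewrite row_free_unit unitmx1.
  - by rewrite subnn addn0.
  - by move=> x _ _; exists x; rewrite mulmx1 addr0.
  - by move=> t; rewrite -KI; split=> [[]|].
  - apply: (@affine_hull_setT _ _ _ y) => /=.
      by rewrite mulmx1 addr0; split=> // i iK; apply/ltW/ly.
    move=> v; have := intK y ly v; apply: filterS => t H.
    by rewrite mulmx1 addr0.
(* Otherwise the face would contain a point strict for all constraints, from
   which one could move in P in the direction where g increases. *)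
have [j jK ljF] : exists2 j, j \in K &
    forall x, nonpos_on l K x -> g x = 0 -> l j x = 0.
  apply: contrapT => /forall2NP ljF.
  have [|||x y' [Kx gx] [Ky gy]|i iK|x [_ gx] lx] :=
    @common_strict_point _ _ l K [set x | nonpos_on l K x /\ g x = 0].
  - exact: lA.
  - by exists z.
  - by move=> x [].
  - split; last by rewrite affine_function_line// gx gy subr0 mulr0 addr0.
    move=> i iK; rewrite affine_function_line//.
    by have := Kx i iK; have := Ky i iK; lra.
  - have [//|/existsNP[x /not_implyP[Kx /not_implyP[gx lx]]]] := ljF i.
    by exists x => //; rewrite lt_neqAle Kx// andbT; exact/eqP.
  - have gline t w : g (x + t *: (w - x)) = t * g w.
      by rewrite affine_function_line// gx subr0 add0r.
    have [gv0|gv0] := ltP 0 (g v).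
      have [t t0 /gK] := near_right0_ex (intK x lx (v - x)).
      by rewrite gline leNgt mulr_gt0.
    have [t t0 /gK] := near_right0_ex (intK x lx (- (v - x))).
    rewrite scalerN -scaleNr gline mulNr oppr_le0 pmulr_rge0// => gv1.
    by apply: gv; apply/eqP; rewrite eq_le gv0.
(* u is the point where the segment from the interior point y to w, which
   violates l j alone, crosses the hyperplane l j = 0. *)
have [w [lw ljw]] := irr j jK.
have ljy : l j y < 0 by exact: ly.
have den : 0 < l j w - l j y by lra.
pose s := - l j y / (l j w - l j y); pose u := y + s *: (w - y).
have s01 : 0 < s < 1.
  by rewrite divr_gt0 ?oppr_gt0//= ltr_pdivrMr// mul1r; lra.
have lju : l j u = 0.
  by rewrite affine_function_line// divfK ?lt0r_neq0// addrN.
have lu i : i \in K :\ j -> l i u < 0.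
  move=> iK; rewrite affine_function_line//.
  have iK' : i \in K by move: iK; rewrite inE => /andP[].
  have := ly i iK'; have := lw i iK; case/andP: s01; nra.
have [d' [M [dE Mfree ljM MH]]] :=
  @hyperplane_param _ (l j) u w (lA j) lju (lt0r_neq0 ljw).
have [i0 i0I pi0] := vanishing_on_hyperplane lA pP KI jK lu ljw ljM.
have KM t : nonpos_on (fun i t => l i (t *m M + u)) (K :\ j) t <->
    nonpos_on l K (t *m M + u).
  split=> H i; last by rewrite inE => /andP[_ /H].
  move=> iK; have [->|ij] := eqVneq i j; first by rewrite ljM.
  by apply: H; rewrite !inE ij.
have IM t : nonneg_on (fun i t => p i (t *m M + u)) (I :\ i0) t <->
    nonneg_on p I (t *m M + u).
  split=> H i; last by rewrite inE => /andP[_ /H].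
  move=> iI; have [->|ij] := eqVneq i i0; first by rewrite pi0.
  by apply: H; rewrite !inE ij.
have d'd : (d' < d)%N by rewrite dE.
have [|||||||k [N [v' [I' [Nfree cI' Nsurj NI' NT]]]]] := IH d' d'd
  (fun i t => l i (t *m M + u)) (K :\ j) (fun i t => p i (t *m M + u))
  (I :\ i0) (fun t => g (t *m M + u)).
- by move=> i; exact: affine_function_comp.
- by move=> i; exact: line_polynomial_comp.
- exact: affine_function_comp.
- by exists 0 => i iK; rewrite mul0mx add0r lu.
- by apply/seteqP; split=> t; [move/KM|move/IM];
    [rewrite KI => /IM|rewrite -KI => /KM].
- by move=> t /KM/gK.
- have [t zt] := MH z (ljF z Kz gz).
  by exists t; rewrite -?zt//; apply/KM; rewrite -zt.
have comp t : t *m (N *m M) + (v' *m M + u) = (t *m N + v') *m M + u.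
  by rewrite mulmxDl mulmxA addrA.
exists k, (N *m M), (v' *m M + u), I'; split.
- by rewrite /row_free mxrankMfree.
- move: cI'; rewrite (cardsD1 i0 I) i0I dE subSn ?addnS//.
  by have := rank_leq_col N; rewrite (eqP Nfree).
- move=> x Kx gx; have [t xE] := MH x (ljF x Kx gx).
  have Kt : nonpos_on (fun i t => l i (t *m M + u)) (K :\ j) t.
    by apply/KM; rewrite -xE.
  have gt0 : g (t *m M + u) = 0 by rewrite -xE.
  have [t' t'E] := Nsurj t Kt gt0.
  by exists t'; rewrite comp -t'E.
- move=> t; rewrite comp; split=> [[/KM Kt ge]|It]; first by apply/NI'; split.
  by have [/KM] := (NI' t).2 It.
- rewrite -NT; congr affine_hull.
  by apply/seteqP; split=> t /=; rewrite comp => -[/KM Kt ge]; split.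
Qed.

End Faces.

(** * Polynomial descriptions of a polyhedron and of its faces *)

Section Descriptions.
Variable R : realType.

Lemma mpoly_affine_subst d k (p : {mpoly R[d]}) (M : 'M[R]_(k, d)) u :
  exists q : {mpoly R[k]}, forall t : 'rV[R]_k,
    q.@[fun j => t ord0 j] = p.@[fun j => (t *m M + u) ord0 j].
Proof.
exists (p \mPo [tuple \sum_j M j i *: 'X_j + (u ord0 i)%:MP | i < d]) => t.
rewrite comp_mpoly_meval; apply: meval_eq => i.
rewrite tnth_mktuple mevalD mevalC raddf_sum !mxE; congr (_ + _).
by apply: eq_bigr => j _; rewrite /= mevalZ mevalXU mulrC.
Qed.

Lemma affine_function_mpoly d (l : 'rV[R]_d -> R) : affine_function l ->
  exists q : {mpoly R[d]}, forall x : 'rV[R]_d, q.@[fun j => x ord0 j] = l x.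
Proof.
move=> [a [b lE]].
have [q qE] := mpoly_affine_subst ('X_ord0 : {mpoly R[1]}) a^T (const_mx (- b)).
by exists q => x; rewrite qE mevalXU mxE -dotp_mulmx mxE lE.
Qed.

Lemma polyhedron_system d (P : set 'rV[R]_d) : polyhedron P ->
  exists m (l : 'I_m -> 'rV[R]_d -> R),
    [/\ forall i, affine_function (l i), forall i, exists x, l i x != 0 &
        P = nonpos_on l [set: 'I_m]].
Proof.
move=> [m [H [Hhalf ->]]]; have [a aH] := choice Hhalf; have [b abH] := choice aH.
exists m, (fun i x => dotp (a i) x - b i); split=> [i|i|].
- by exists (a i), (b i).
- have [/eqP ai _] := abH i; apply: contrapT => /forallNP l0; apply: ai.
  have {}l0 x : dotp (a i) x = b i.
    by apply/eqP; rewrite -subr_eq0; apply/negPn/negP/l0.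
  have b0 : b i = 0 by rewrite -(l0 0) dotp_mulmx mul0mx mxE.
  apply/rowP => j; rewrite !mxE; have := l0 (delta_mx 0 j).
  by rewrite b0 dotp_mulmx -rowE !mxE.
- apply/seteqP; split=> x Px i _.
    by have := Px i I; have [_ ->] := abH i; rewrite /= subr_le0.
  by have [_ ->] := abH i; rewrite /= -subr_le0; apply: Px; rewrite inE.
Qed.

(** A constraint that is nowhere strict on P vanishes on P, hence on the affine
    hull of P, which is the whole space. *)
Lemma full_dim_strict_point d m (l : 'I_m -> 'rV[R]_d -> R) (K : {set 'I_m}) :
  (forall i, affine_function (l i)) -> (forall i, exists x, l i x != 0) ->
  has_dim (nonpos_on l K) d -> exists y, forall i, i \in K -> l i y < 0.
Proof.
move=> lA l0 Kd; have /has_dim_setT hullT := Kd.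
have [|x y Kx Ky i iK|i iK|y _ ly] :=
  common_strict_point lA _ (@subset_refl _ (nonpos_on l K)).
- exact: has_dim_nonempty Kd.
- by rewrite affine_function_line//; have := Kx i iK; have := Ky i iK; lra.
- apply: contrapT => /forall2NP noneg; have [x /eqP] := l0 i; apply.
  apply: (@affine_hull_eq0 _ _ (nonpos_on l K)) => [//|z Kz|].
    apply/eqP; rewrite eq_le Kz// leNgt; apply/negP => lz.
    by have [] := noneg z.
  by rewrite hullT.
- by exists y.
Qed.

Lemma polyhedron_described d (P : set 'rV[R]_d) : polyhedron P ->
  exists n (p : 'I_n -> {mpoly R[d]}), described_by P p.
Proof.
move=> /polyhedron_system[m [l [lA _ ->]]].
have [q qE] := choice (fun i => affine_function_mpoly (lA i)).
exists m, (fun i => - q i); apply/seteqP; split=> x lx i.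
  by rewrite mevalN qE oppr_ge0 lx ?inE.
by move=> _; have := lx i; rewrite mevalN qE oppr_ge0.
Qed.

Lemma mP_min d (P : set 'rV[R]_d) n : describable P n ->
  describable P (mP P) /\ forall n', describable P n' -> (mP P <= n')%N.
Proof.
move=> Pn; rewrite /mP; apply: (@xgetPex _ 0%N [set l | describable P l /\
  forall l', describable P l' -> (l <= l')%N]).
have ex : exists l, `[< describable P l >] by exists n; apply/asboolP.
case: (ex_minnP ex) => l /asboolP Pl lmin; exists l; split=> // l' Pl'.
by apply: lmin; apply/asboolP.
Qed.

Lemma describable_full d (P : set 'rV[R]_d) n : has_dim P d ->
  describable P n <-> exists p : 'I_n -> {mpoly R[d]}, described_by P p.
Proof.
move=> Pd; split=> [[[]//|[k [kd Pk _]]]|Pp]; last by left.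
by move: kd; rewrite (has_dim_uniq Pk Pd) ltnn.
Qed.

(** The parametrization of the affine hull of F given by face_parametrization is
    inverted by an affine map of the whole space, which serves as the required
    embedding of F; the surviving polynomials, pulled back along the
    parametrization, describe the image. *)
Lemma face_describable d n (P F : set 'rV[R]_d) k (p : 'I_n -> {mpoly R[d]}) :
  polyhedron P -> has_dim P d -> described_by P p ->
  face F P -> F !=set0 -> has_dim F k ->
  exists2 n', (n' + (d - k) <= n)%N & describable F n'.
Proof.
move=> /polyhedron_system[m [l [lA l0 PE]]] Pd Pp [a [b [Pab FE]]] [z Fz] Fk.
pose f i (x : 'rV[R]_d) := (p i).@[fun j => x ord0 j].
have PI : P = nonneg_on f [set: 'I_n].
  by rewrite Pp; apply/seteqP; split=> x px i *; apply: px; rewrite ?inE.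
have [||||||k' [M [u [I' [Mfree cI' Msurj FI' hullT]]]]] :=
  @face_parametrization _ _ _ _ l [set: 'I_m] f [set: 'I_n] (fun x => dotp a x - b) lA.
- by move=> i; exact: mpoly_line_polynomial.
- by exists a, b.
- by apply: full_dim_strict_point => //; rewrite -PE.
- by rewrite -PE -PI.
- by move=> x; rewrite -PE subr_le0 => /Pab.
- by move: Fz; rewrite FE PE => -[Kz /= ab]; exists z; rewrite // ab subrr.
have FM : F = [set t *m M + u | t in
    [set t | nonpos_on l [set: 'I_m] (t *m M + u) /\ dotp a (t *m M + u) - b = 0]].
  rewrite FE PE; apply/seteqP; split.
    move=> x [Px /= /eqP]; rewrite -subr_eq0 => /eqP ab.
    by have [t xE] := Msurj x Px ab; exists t; rewrite -?xE.
  by move=> _ [t [Pt /eqP ab] <-]; split=> //=; apply/eqP; rewrite -subr_eq0.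
have {}Fk : k' = k by apply: has_dim_uniq Fk; rewrite FM; exact: has_dim_param.
rewrite {}Fk {k'} in M u Mfree cI' Msurj FI' hullT FM *.
exists #|I'|; first by rewrite cardsT card_ord in cI'.
have kd : (k <= d)%N by have := rank_leq_col M; rewrite (eqP Mfree).
have Fdim : has_dim F k by rewrite FM; exact: has_dim_param.
(* If k = d, the parametrization is onto, and the surviving polynomials describe
   F without any substitution. *)
move: kd; rewrite leq_eqVlt => /predU1P[kd|kd].
  left; rewrite -{2}kd; split=> //; exists (fun i => p (enum_val i)).
  have surj x : exists t, x = t *m M + u.
    exists ((x - u) *m pinvmx M).
    by rewrite mulmxKpV ?subrK// submx_full// /row_full (eqP Mfree) kd.
  have FEI t : F (t *m M + u) <-> nonneg_on f I' (t *m M + u).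
    rewrite -FI' FE PE; split=> -[Kt ab]; split=> //.
      by rewrite ab subrr.
    by apply/eqP; rewrite /= -subr_eq0; apply/eqP.
  apply/seteqP; split=> x; have [t ->] := surj x.
    by move=> /FEI Ft i; apply: Ft; exact: enum_valP.
  move=> Ft; apply/FEI => i iI.
  by have := Ft (enum_rank_in iI i); rewrite enum_rankK_in.
right; exists k; split=> //.
have [q qE] := choice (fun i => mpoly_affine_subst (p i) M u).
exists (fun x => x *m pinvmx M - u *m pinvmx M), (fun i => q (enum_val i)).
have fK t : (t *m M + u) *m pinvmx M - u *m pinvmx M = t.
  by rewrite mulmxDl mulmxKp// addrK.
split.
  split; first by exists (pinvmx M), (- (u *m pinvmx M)).
  have hull x : affine_hull F x -> exists t, x = t *m M + u.
    move=> [r [c [y [Fy c1 ->]]]].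
    have /choice[t tE] : forall i, exists t, y i = t *m M + u.
      by move=> i; have := Fy i; rewrite {1}FM => -[t _ <-]; exists t.
    exists (\sum_i c i *: t i); rewrite mulmx_suml -[u]scale1r -c1 scaler_suml.
    by rewrite -big_split; apply: eq_bigr => i _; rewrite tE /= scalerDr scalemxAl.
  by move=> x y /hull[s ->] /hull[t ->]; rewrite !fK => ->.
apply/seteqP; split.
  move=> _ [x Fx <-]; move: Fx; rewrite {1}FM => -[t Ft <-] i; rewrite fK qE.
  by move: Ft => /FI'; apply; exact: enum_valP.
move=> t /= qt; exists (t *m M + u); last by rewrite fK.
rewrite FM; exists t => //; apply/FI' => i iI.
by have := qt (enum_rank_in iI i); rewrite enum_rankK_in// qE.
Qed.

Lemma mP_face d (P F : set 'rV[R]_d) k :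
  polyhedron P -> has_dim P d -> face F P -> F !=set0 -> has_dim F k ->
  (mP P >= mP F + (d - k))%N.
Proof.
move=> Ppoly Pd FP F0 Fk; have [n Pn] := polyhedron_described Ppoly.
have [/(describable_full _ Pd)[p Pp] _] := mP_min ((describable_full _ Pd).2 Pn).
have [n' n'P Fn'] := face_describable Ppoly Pd Pp FP F0 Fk.
have [_ /(_ _ Fn') Fmin] := mP_min Fn'.
by apply: leq_trans n'P; rewrite leq_add2r.
Qed.

End Descriptions.

(** * Vertices of polytopes *)

Section Vertices.
Variable R : realType.

Lemma has_dim_set1 d (z : 'rV[R]_d) : has_dim [set z] 0.
Proof.
have -> : [set z] = [set t *m (0 : 'M[R]_(0, d)) + z | t in setT].
  apply/seteqP; split=> [x ->|_ [t _ <-]]; last by rewrite mulmx0 add0r.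
  by exists 0 => //; rewrite mulmx0 add0r.
apply: has_dim_param; first by rewrite /row_free mxrank0.
by apply/seteqP; split=> // x _; exact: sub_affine_hull.
Qed.

Lemma continuous_sum (T : topologicalType) d (f : 'I_d -> T -> R) :
  (forall i, continuous (f i)) -> continuous (fun x => \sum_i f i x).
Proof.
move=> fc; elim: (index_enum _) => [|i s IH].
  under eq_fun do rewrite big_nil; exact: cst_continuous.
under eq_fun do rewrite big_cons.
by move=> x; apply: cvgD; [exact: fc|exact: IH].
Qed.

Lemma continuous_dotp (T : topologicalType) d (f g : T -> 'rV[R]_d) :
  (forall i, continuous (fun x => f x ord0 i)) ->
  (forall i, continuous (fun x => g x ord0 i)) ->
  continuous (fun x => dotp (f x) (g x)).
Proof.
move=> fc gc; apply: continuous_sum => i x.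
by apply: cvgM; [exact: fc|exact: gc].
Qed.

Lemma dotp_continuous d (a : 'rV[R]_d) : continuous (dotp a).
Proof.
apply: (@continuous_dotp 'rV[R]_d d (fun=> a) id) => i; last exact: coord_continuous.
exact: cst_continuous.
Qed.

Lemma sqnorm_continuous d : continuous (fun x : 'rV[R]_d => dotp x x).
Proof.
by apply: (@continuous_dotp 'rV[R]_d d id id) => i; exact: coord_continuous.
Qed.

Lemma polyhedron_closed d (P : set 'rV[R]_d) : polyhedron P -> closed P.
Proof.
move=> [m [H [Hhalf ->]]]; apply: closed_bigI => i _.
have [a [b [_ ->]]] := Hhalf i.
rewrite (_ : [set _ | _] = dotp a @^-1` [set y | y <= b])//.
by apply: preimage_closed; [move=> x _; exact: dotp_continuous|exact: closed_le].
Qed.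

Lemma sqnormB d (x z : 'rV[R]_d) :
  dotp (x - z) (x - z) = dotp x x - 2 * dotp z x + dotp z z.
Proof.
rewrite /dotp mulr_sumr -sumrB -big_split; apply: eq_bigr => i _ /=.
by rewrite !mxE; ring.
Qed.

Lemma sqnorm_ge0 d (x : 'rV[R]_d) : 0 <= dotp x x.
Proof. by apply: sumr_ge0 => i _; rewrite -expr2 sqr_ge0. Qed.

Lemma sqnorm_eq0 d (x : 'rV[R]_d) : dotp x x = 0 -> x = 0.
Proof.
move=> /eqP; rewrite psumr_eq0; last by move=> i _; rewrite -expr2 sqr_ge0.
move=> /allP x0; apply/rowP => i; apply/eqP.
by have := x0 i (mem_index_enum i); rewrite mulf_eq0 orbb mxE.
Qed.

(** A point z of P with the largest Euclidean norm is a vertex: for x in P,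
    0 <= |x - z|^2 = |x|^2 - 2 <z, x> + |z|^2 gives <z, x> <= |z|^2, with equality
    only if x = z. *)
Lemma polytope_vertex d (P : set 'rV[R]_d) :
  polytope P -> P !=set0 -> exists z, face [set z] P.
Proof.
move=> [Ppoly Pbnd] P0.
have Pcpt := bounded_closed_compact Pbnd (polyhedron_closed Ppoly).
have [|z + zmax] := EVT_max_rV P0 Pcpt (f := fun x => dotp x x).
  by apply: continuous_subspaceT; exact: sqnorm_continuous.
rewrite inE => Pz.
have {}zmax x : P x -> dotp x x <= dotp z z by move=> Px; apply: zmax; rewrite inE.
exists z, z, (dotp z z); split=> [x Px /=|].
  by have := sqnorm_ge0 (x - z); have := zmax x Px; rewrite sqnormB; lra.
apply/seteqP; split=> [x -> //|x [Px /= zx]].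
apply/eqP; rewrite -subr_eq0; apply/eqP/sqnorm_eq0/le_anti.
by rewrite sqnorm_ge0 andbT sqnormB zx; have := zmax x Px; lra.
Qed.

Lemma mP_polytope d (P : set 'rV[R]_d) :
  polytope P -> has_dim P d -> (mP P >= d)%N.
Proof.
move=> Ptope Pd; have [z zP] := polytope_vertex Ptope (has_dim_nonempty Pd).
have := mP_face Ptope.1 Pd zP (ex_intro _ z erefl) (has_dim_set1 z).
by rewrite subn0; apply: leq_trans; rewrite leq_addl.
Qed.

End Vertices.

(** * Prisms *)

Section Prisms.
Variable R : realType.

Definition prism d (P : set 'rV[R]_d) : set 'rV[R]_d.+1 :=
  [set x : 'rV[R]_(1 + d) | P (rsubmx x) /\ 0 <= lsubmx x 0 0 <= 1].

Definition prism_base d (P : set 'rV[R]_d) : set 'rV[R]_d.+1 :=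
  [set t *m (row_mx 0 1%:M : 'M[R]_(d, 1 + d)) + 0 | t in P].

Lemma dotp_row_mx d (c : 'rV[R]_1) (a : 'rV[R]_d) (x : 'rV[R]_(1 + d)) :
  @dotp R d.+1 (row_mx c a) x = c 0 0 * lsubmx x 0 0 + dotp a (rsubmx x).
Proof.
transitivity (\sum_(i < 1 + d) row_mx c a 0 i * x 0 i) => //.
rewrite big_split_ord big_ord1 row_mxEl mxE; congr (_ + _).
by apply: eq_bigr => i _; rewrite row_mxEr mxE.
Qed.

Lemma halfspace_polyhedron d (H : set 'rV[R]_d) :
  closed_halfspace H -> polyhedron H.
Proof.
move=> Hh; exists 1, (fun=> H); split=> //.
by apply/seteqP; split=> x Hx; [move=> i _|exact: (Hx ord0)].
Qed.

Lemma polyhedronI d (P Q : set 'rV[R]_d) :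
  polyhedron P -> polyhedron Q -> polyhedron (P `&` Q).
Proof.
move=> [m [H [Hh ->]]] [n [G [Gh ->]]].
exists (m + n)%N, (fun i => match split i with inl j => H j | inr j => G j end).
split=> [i|]; first by case: (split i).
apply/seteqP; split=> x.
  by move=> [Hx Gx] i _; case: (split i) => j; [exact: Hx|exact: Gx].
move=> HGx; split=> i _.
  by have := HGx (lshift n i) I; rewrite (unsplitK (inl i)).
by have := HGx (rshift m i) I; rewrite (unsplitK (inr i)).
Qed.

Lemma prism_polyhedron d (P : set 'rV[R]_d) : polyhedron P -> polyhedron (prism P).
Proof.
move=> [m [H [Hh PE]]].
have -> : prism P = [set x : 'rV[R]_(1 + d) | P (rsubmx x)] `&`
    ([set x : 'rV[R]_(1 + d) | - lsubmx x 0 0 <= 0] `&`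
     [set x : 'rV[R]_(1 + d) | lsubmx x 0 0 <= 1]).
  apply/seteqP; split=> x /=; rewrite oppr_le0 /prism /=.
    by move=> [Px /andP].
  by move=> [Px x01]; split=> //; apply/andP.
apply: polyhedronI; last apply: polyhedronI.
- exists m, (fun i => [set x : 'rV[R]_(1 + d) | H i (rsubmx x)]); split=> [i|].
    have [a [b [a0 ->]]] := Hh i; exists (row_mx (0 : 'rV_1) a : 'rV[R]_(1 + d)), b.
    split; last first.
      by apply/seteqP; split=> x /=; rewrite dotp_row_mx mxE mul0r add0r.
    by apply: contra_neq a0 => /(congr1 (@rsubmx R 1 1 d)); rewrite row_mxKr raddf0.
  by apply/seteqP; split=> x /=; rewrite PE => Hx i _; exact: Hx.
- apply: halfspace_polyhedron.
  exists (row_mx (const_mx (-1) : 'rV_1) 0 : 'rV[R]_(1 + d)), 0; split.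
    apply/eqP => /(congr1 (fun y => @lsubmx R 1 1 d y 0 0)).
    by rewrite row_mxKl raddf0 !mxE => /eqP; rewrite oppr_eq0 oner_eq0.
  by apply/seteqP; split=> x /=; rewrite dotp_row_mx dotp_mulmx trmx0 mulmx0
    !mxE mulN1r addr0.
- apply: halfspace_polyhedron.
  exists (row_mx (const_mx 1 : 'rV_1) 0 : 'rV[R]_(1 + d)), 1; split.
    apply/eqP => /(congr1 (fun y => @lsubmx R 1 1 d y 0 0)).
    by rewrite row_mxKl raddf0 !mxE => /eqP; rewrite oner_eq0.
  by apply/seteqP; split=> x /=; rewrite dotp_row_mx dotp_mulmx trmx0 mulmx0
    !mxE mul1r addr0.
Qed.

Lemma prism_has_dim d (P : set 'rV[R]_d) : has_dim P d -> has_dim (prism P) d.+1.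
Proof.
move=> /has_dim_setT PT; apply/has_dim_setT/seteqP; split=> // x _.
pose M : 'M[R]_(d, 1 + d) := row_mx (0 : 'M_(d, 1)) 1%:M.
have base (c : R) v : 0 <= c <= 1 ->
    affine_hull (prism P) (row_mx (c%:M : 'rV_1) v).
  move=> c01.
  have -> : row_mx (c%:M : 'rV_1) v = v *m M + row_mx c%:M 0.
    by rewrite /M mul_mx_row mulmx0 mulmx1 add_row_mx addr0 add0r.
  apply: affine_hull_mono (affine_hull_image M _ (_ : affine_hull P v)).
    move=> _ [t Pt <-]; rewrite /prism /M /= mul_mx_row mulmx0 mulmx1 add_row_mx.
    by rewrite row_mxKl row_mxKr add0r addr0 mxE eqxx mulr1n.
  by rewrite PT.
have x0 := base 0 (@rsubmx R 1 1 d x) ltac:(by rewrite lexx ler01).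
have x1 := base 1 (@rsubmx R 1 1 d x) ltac:(by rewrite ler01 lexx).
have xE : row_mx (0%:M : 'rV_1) (@rsubmx R 1 1 d x) +
    @lsubmx R 1 1 d x 0 0 *: (row_mx 1%:M (@rsubmx R 1 1 d x) -
    row_mx 0%:M (@rsubmx R 1 1 d x)) = x :> 'rV[R]_(1 + d).
  rewrite opp_row_mx add_row_mx scale_row_mx add_row_mx subrr scaler0 addr0.
  rewrite -[RHS](@hsubmxK R 1 1 d); congr row_mx.
  by apply/rowP => i; rewrite !ord1 !mxE eqxx /= !mulr1n subr0 mulr1 add0r.
by have := affine_hull_line (@lsubmx R 1 1 d x 0 0) x0 x1; rewrite xE.
Qed.

Lemma prism_bounded d (P : set 'rV[R]_d) : bounded_set P -> bounded_set (prism P).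
Proof.
move=> [B [_ PB]]; have B1 : B < Num.max B 0 + 1.
  by rewrite (@le_lt_trans _ _ (Num.max B 0))// ?le_max ?lexx// ltrDl.
pose C := Num.max B 0 + 1.
have C1 : 1 <= C by rewrite lerDr le_max lexx orbT.
exists C; split; first by rewrite num_real.
move=> D CD x [Px x01].
have D0 : 0 <= D by rewrite (le_trans _ (ltW CD))// (le_trans _ C1).
rewrite /= -[leLHS]/(mx_norm x) mx_normrE; apply: bigmax_le => // -[i j] _ /=.
rewrite ord1 {i}.
rewrite -(@splitK 1 d j); case: (split _) => /= k.
  have -> : k = ord0 by apply/val_inj; case: k => -[].
  move: x01; rewrite mxE => /andP[x0 x1]; rewrite ger0_norm//.
  by rewrite (le_trans x1)// (le_trans C1)// ltW.
have := PB C B1 _ Px.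
rewrite /= -[leLHS]/(mx_norm _) mx_normrE => /bigmax_leP[_ /(_ (ord0, k) isT)].
by rewrite /= mxE => /le_trans; apply; exact: ltW.
Qed.

Lemma prism_base_face d (P : set 'rV[R]_d) : face (prism_base P) (prism P).
Proof.
have dE (x : 'rV[R]_(1 + d)) :
    @dotp R d.+1 (row_mx (const_mx (-1) : 'rV_1) (0 : 'rV_d)) x = - lsubmx x 0 0.
  by rewrite dotp_row_mx dotp_mulmx trmx0 mulmx0 !mxE mulN1r addr0.
exists (row_mx (const_mx (-1) : 'rV_1) (0 : 'rV_d)), 0; split.
  by move=> x [_ /andP[x0 _]] /=; rewrite dE oppr_le0.
apply/seteqP; split=> x.
  move=> [t Pt <-]; rewrite addr0 mul_mx_row mulmx0 mulmx1; split.
    by rewrite /prism /= row_mxKl row_mxKr mxE lexx ler01.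
  by rewrite /= dE row_mxKl mxE oppr0.
move=> [[Px _]] /=; rewrite dE => /eqP; rewrite oppr_eq0 => /eqP x0.
exists (@rsubmx R 1 1 d x) => //; rewrite addr0 mul_mx_row mulmx0 mulmx1.
rewrite -[RHS](@hsubmxK R 1 1 d); congr row_mx.
by apply/rowP => i; rewrite !ord1 x0 mxE.
Qed.

Lemma row_mx01_free d : row_free (row_mx 0 1%:M : 'M[R]_(d, 1 + d)).
Proof.
apply/row_freeP; exists (col_mx 0 1%:M).
by rewrite mul_row_col mul0mx add0r mulmx1.
Qed.

Lemma prism_base_has_dim d (P : set 'rV[R]_d) :
  has_dim P d -> has_dim (prism_base P) d.
Proof.
by move=> /has_dim_setT PT; apply: has_dim_param; [exact: row_mx01_free|].
Qed.

(** Together with mP_min, this says that an affine copy of P in a space of larger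
    dimension needs at least as many polynomials as P. *)
Lemma describable_of_affine_copy d k (P : set 'rV[R]_d) (M : 'M[R]_(d, k)) u n :
  (d < k)%N -> has_dim P d -> row_free M ->
  describable [set t *m M + u | t in P] n -> describable P n.
Proof.
move=> dk Pd Mfree; have /has_dim_setT PT := Pd.
have Qd : has_dim [set t *m M + u | t in P] d by exact: has_dim_param.
move=> [[/(has_dim_uniq Qd) kd]|]; first by rewrite {1}kd ltnn in dk.
move=> [j [_ /(has_dim_uniq Qd) <- [f [p [[[A [b fE]] finj] Qp]]]]].
left; split=> //.
have [q qE] := choice (fun i => mpoly_affine_subst (p i) (M *m A) (u *m A + b)).
exists q.
have fM t : f (t *m M + u) = t *m (M *m A) + (u *m A + b).
  by rewrite fE mulmxDl mulmxA addrA.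
have hull t : affine_hull [set t *m M + u | t in P] (t *m M + u).
  by apply: affine_hull_image; rewrite PT.
apply/seteqP; split=> x.
  move=> Px i; rewrite qE -fM.
  have : (f @` [set t *m M + u | t in P]) (f (x *m M + u)).
    by exists (x *m M + u) => //; exists x.
  by rewrite Qp; exact.
move=> qx; have : (f @` [set t *m M + u | t in P]) (f (x *m M + u)).
  by rewrite Qp => i; rewrite fM -qE; exact: qx.
move=> [_ [t Pt <-]] /(finj _ _ (hull t) (hull x)) /addIr.
by move=> /(row_free_inj Mfree) <-.
Qed.

(** The base of the prism is a copy of P and a face of codimension one. *)
Lemma mP_prism d (P : set 'rV[R]_d) : polyhedron P -> has_dim P d ->
  (mP (prism P) >= mP P + 1)%N.
Proof.
move=> Ppoly Pd; have Qpoly := prism_polyhedron Ppoly.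
have Qd := prism_has_dim Pd; have Bd := prism_base_has_dim Pd.
have B0 := has_dim_nonempty Bd.
have := mP_face Qpoly Qd (prism_base_face P) B0 Bd.
rewrite subSnn; apply: leq_trans; rewrite leq_add2r.
have [n [p Qp]] := polyhedron_described Qpoly.
have [n' _ Bn'] := face_describable Qpoly Qd Qp (prism_base_face P) B0 Bd.
have [Bmin _] := mP_min Bn'.
have Pn := describable_of_affine_copy (ltnSn d) Pd (row_mx01_free d) Bmin.
by have [_] := mP_min Pn; exact.
Qed.

(** The 1 is moved to the right, where it can be subtracted even if the suprema
    are infinite. *)
Lemma ereal_sup_add1 (A B : set (\bar R)) :
  (forall a, A a -> exists2 b, B b & (a + 1 <= b)%E) ->
  (ereal_sup A + 1 <= ereal_sup B)%E.
Proof.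
move=> AB; rewrite -leeBrDr//; apply: ge_ereal_sup => a Aa.
have [b Bb ab] := AB a Aa; rewrite leeBrDr//.
by apply: le_trans ab _; exact: ereal_sup_ubound.
Qed.

End Prisms.

Theorem corollary2p2 (R : realType) :
  ((forall (d : nat) (P F : set 'rV[R]_d) (k : nat),
      polyhedron P -> has_dim P d ->
      face F P -> F !=set0 -> has_dim F k ->
      (mP P >= mP F + (d - k))%N) /\
   (forall (d : nat) (P : set 'rV[R]_d),
      polytope P -> has_dim P d -> (mP P >= d)%N)) /\
  (forall d : nat,
     (mP_max_polytope R d.+1 >= mP_max_polytope R d + 1)%E /\
     (mP_max_polyhedron R d.+1 >= mP_max_polyhedron R d + 1)%E).
Proof.
split; first by split=> *; [exact: mP_face|exact: mP_polytope].
move=> d; split; apply: ereal_sup_add1 => _ [P [Ppoly Pd] <-].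
- exists (mP (prism P))%:R%:E; last first.
    by rewrite -EFinD lee_fin natr1 ler_nat -addn1 mP_prism//; exact: Ppoly.1.
  exists (prism P) => //; split; last exact: prism_has_dim.
  by split; [apply: prism_polyhedron; exact: Ppoly.1|];
    apply: prism_bounded; exact: Ppoly.2.
- exists (mP (prism P))%:R%:E; last first.
    by rewrite -EFinD lee_fin natr1 ler_nat -addn1 mP_prism.
  by exists (prism P) => //; split; [exact: prism_polyhedron|exact: prism_has_dim].
Qed.
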